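(* Let $a,b$ be integers with $a>b\geq 1$, and set $q=2^{b+1}-1$ and $p=2^{a+1}-(2^b+1)$. Then $n=pq\,2^a$ is strongly pseudoperfect. Moreover, if $p$ and $q$ are prime, then $n$ is strongly pseudoperfect with exactly four omitted divisors, i.e. $n$ has a strongly pseudoperfect representation with exactly four omitted divisors.
   Context: A positive integer $n$ is strongly pseudoperfect if there is a subset $S$ of the positive divisors of $n$ (with $1$ and $n$ themselves allowed) such that $d\in S$ if and only if $n/d\in S$ for every positive divisor $d$ of $n$, and $\sum_{d\in S} d = 2n$. Such a set $S$ is called a strongly pseudoperfect representation of $n$. A positive divisor of $n$ that is not in $S$ is called an omitted divisor of the representation. *)

(* Defs.v *)
From HB Require Import structures.
From mathcomp Require Import all_boot finmap.

Set Implicit Arguments.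
Unset Strict Implicit.
Unset Printing Implicit Defensive.

Definition strongly_pseudoperfect_rep (n : nat) (S : {fset nat}) : Prop :=
  [/\ {in S, forall d, d %| n},
      forall d : nat, d %| n -> (d \in S <-> n %/ d \in S)
    & \sum_(d <- S) d = 2 * n].

(* Without 0 < n, the empty set would represent 0. *)
Definition strongly_pseudoperfect (n : nat) : Prop :=
  0 < n /\ exists S : {fset nat}, strongly_pseudoperfect_rep n S.

Definition omitted_divisors (n : nat) (S : {fset nat}) : {fset nat} :=
  [fset d in divisors n | d \notin S]%fset.

(* Main.v *)
(** The divisors [c * 2 ^ i] of [n], for [c] in [1, p, q, p * q] and [i <= a],
    are pairwise distinct because [p] and [q] are odd, distinct and greater
    than [1], whether or not they are prime.  With [A = 2 ^ (a + 1)] and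
    [B = 2 ^ b] their sum is [(p + 1) * (q + 1) * (A - 1)], which exceeds [2 * n]
    by [p * A + 2 * B ^ 2].  This excess is the sum of the two complementary
    pairs [2 ^ b, p * q * 2 ^ (a - b)] and [q * 2 ^ b, p * 2 ^ (a - b)], so
    removing them leaves a representation.  When [p] and [q] are prime, the
    listed divisors are all the divisors of [n]. *)
Require Import Defs.
From HB Require Import structures.
From mathcomp Require Import all_boot finmap.
From mathcomp Require Import zify ring.

(** Take [d1 = gcdn d m]: the cofactor [d %/ d1] is coprime to [m %/ d1], so by Gauss it divides
    [n]. *)
Lemma dvdn_mul_split (d m n : nat) : 0 < m -> d %| m * n ->
  exists d1 d2, [/\ d1 %| m, d2 %| n & d = d1 * d2].
Proof.
move=> m_gt0 dvd_d; have g_gt0 : 0 < gcdn d m by rewrite gcdn_gt0 m_gt0 orbT.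
exists (gcdn d m), (d %/ gcdn d m); split; first exact: dvdn_gcdr.
  have co : coprime (d %/ gcdn d m) (m %/ gcdn d m).
    rewrite /coprime -(eqn_pmul2r g_gt0) mul1n muln_gcdl.
    by rewrite !divnK ?dvdn_gcdl ?dvdn_gcdr.
  rewrite -(Gauss_dvdr _ co) -(dvdn_pmul2r g_gt0) mulnAC.
  by rewrite !divnK ?dvdn_gcdl ?dvdn_gcdr.
by rewrite mulnC divnK ?dvdn_gcdl.
Qed.

(** The 2-adic valuation recovers the exponent; the power of 2 then cancels. *)
Lemma odd_mul_pow2_inj (c d i j : nat) :
  odd c -> odd d -> c * 2 ^ i = d * 2 ^ j -> c = d /\ i = j.
Proof.
have val2 e k : odd e -> logn 2 (e * 2 ^ k) = k.
  move=> odd_e; rewrite lognM ?expn_gt0 //; last exact: odd_gt0.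
  by rewrite pfactorK // lognE dvdn2 odd_e andbF.
move=> odd_c odd_d eq_cd.
have eq_ij : i = j by rewrite -(val2 c i) // eq_cd val2.
split=> //; apply/eqP; rewrite -(eqn_pmul2r (expn_gt0 2 i)).
by rewrite eq_cd eq_ij.
Qed.

Lemma sum_pow2 (n : nat) : \sum_(i <- iota 0 n) 2 ^ i = 2 ^ n - 1.
Proof.
by rewrite -(subn0 n) -/(index_iota 0 n) subn0 big_mkord subn1 predn_exp mul1n.
Qed.

Definition pow2_multiples (cs : seq nat) (a : nat) : seq nat :=
  [seq c * 2 ^ i | c <- cs, i <- iota 0 a.+1].

Lemma pow2_multiplesP (cs : seq nat) (a d : nat) :
  reflect (exists c i, [/\ c \in cs, i <= a & d = c * 2 ^ i])
          (d \in pow2_multiples cs a).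
Proof.
apply: (iffP allpairsP) => [[[c i] [cs_c]]|[c [i [cs_c le_ia ->]]]].
  by rewrite mem_iota ltnS => le_ia ->; exists c, i.
by exists (c, i); split=> //; rewrite mem_iota ltnS.
Qed.

Lemma pow2_multiples_uniq (cs : seq nat) (a : nat) :
  all odd cs -> uniq cs -> uniq (pow2_multiples cs a).
Proof.
move=> /allP odd_cs uniq_cs; apply: allpairs_uniq; rewrite ?iota_uniq //.
move=> [c i] [d j] /allpairsP[[c' i'] [cs_c _ [-> ->]]].
move=> /allpairsP[[d' j'] [cs_d _ [-> ->]]] /=.
by case/odd_mul_pow2_inj; rewrite ?odd_cs // => -> ->.
Qed.

Lemma sum_pow2_multiples (cs : seq nat) (a : nat) :
  \sum_(d <- pow2_multiples cs a) d = (\sum_(c <- cs) c) * (2 ^ a.+1 - 1).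
Proof.
rewrite big_allpairs_dep -sum_pow2 big_distrl /=.
by apply: eq_bigr => c _; rewrite big_distrr.
Qed.

(** Splitting a divisor along the product leaves a divisor of [p], one of [q] and a power of 2. *)
Lemma mem_pow2_multiples_prime (p q a d : nat) : prime p -> prime q ->
  d %| p * q * 2 ^ a -> d \in pow2_multiples [:: 1; p; q; p * q] a.
Proof.
move=> p_pr q_pr /dvdn_mul_split[]; first by rewrite muln_gt0 !prime_gt0.
move=> d' [e [/dvdn_mul_split[|d1 [d2 [d1p d2q ->]]]]]; first exact: prime_gt0.
case/dvdn_pfactor=> // i le_ia -> ->.
apply/pow2_multiplesP; exists (d1 * d2), i; split=> //.
have [_ /(_ _ d1p)/orP[]/eqP->] := primeP p_pr;
  have [_ /(_ _ d2q)/orP[]/eqP->] := primeP q_pr;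
  by rewrite ?mul1n ?muln1 !inE eqxx ?orbT.
Qed.

Section Representation.
Variables n : nat.
Hypothesis n_gt0 : 0 < n.
Variables s t : seq nat.
Hypotheses (s_uniq : uniq s) (t_uniq : uniq t) (sub_ts : {subset t <= s}).
Hypothesis s_dvd : {in s, forall d, d %| n}.
Hypothesis s_closed : {in s, forall d, n %/ d \in s}.
Hypothesis t_closed : {in t, forall d, n %/ d \in t}.
Hypothesis sum_st : \sum_(d <- s) d = \sum_(d <- t) d + 2 * n.

Let S : {fset nat} := [fset d in s | d \notin t]%fset.

(** Since [d -> n %/ d] is an involution on divisors preserving both [s] and [t], it preserves their
    difference, whose sum is that of [s] minus that of [t]. *)
Lemma strongly_pseudoperfect_rep_diff : strongly_pseudoperfect_rep n S.
Proof.
have codivK d : d %| n -> n %/ (n %/ d) = d by move=> dn; rewrite divnA ?mulKn.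
have codiv_dvd d : d %| n -> n %/ d %| n.
  by move/divnK=> {2}<-; apply: dvdn_mulr.
have S_closed d : d %| n -> d \in S -> n %/ d \in S.
  move=> dn; rewrite !inE /= => /andP[s_d t'd]; rewrite s_closed //=.
  by apply: contra t'd => /t_closed; rewrite codivK.
split.
- by move=> d; rewrite !inE /= => /andP[/s_dvd].
- move=> d dn; split; first exact: S_closed.
  by move=> /(S_closed _ (codiv_dvd _ dn)); rewrite codivK.
apply/eqP; rewrite -(eqn_add2l (\sum_(d <- t) d)) -sum_st; apply/eqP.
rewrite [RHS](bigID (mem t)) /= -[in RHS]big_filter -[X in _ = _ + X]big_filter.
congr (_ + _); apply: perm_big.
  apply: uniq_perm; rewrite ?filter_uniq // => d.
  by rewrite mem_filter /=; case: (boolP (d \in t)) => // /sub_ts.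
apply: uniq_perm; rewrite ?filter_uniq ?fset_uniq // => d.
by rewrite mem_filter !inE /= andbC.
Qed.

Lemma omitted_divisors_diff :
  {subset divisors n <= s} -> #|` omitted_divisors n S|%fset = size t.
Proof.
move=> sub_ds; apply/perm_size/uniq_perm; rewrite ?fset_uniq // => d.
rewrite !inE /= negb_and negbK; case: (boolP (d \in t)) => [t_d|_].
  by rewrite orbT andbT -dvdn_divisors // s_dvd ?sub_ts.
by rewrite orbF; apply/negbTE/negP => /andP[/sub_ds->].
Qed.

End Representation.

(* The nesting and the [+ 0] are those of unfolded sums over explicit lists. *)
Lemma sum_excess (p q B C : nat) :
  p + B + 1 = 2 * (B * C) -> q + 1 = 2 * B ->
  (1 + (p + (q + (p * q + 0)))) * (p + B) =
  B + (p * C + (q * B + (p * q * C + 0))) + 2 * (p * q * (B * C)).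
Proof.
move=> pE qE; transitivity ((q + 1) * (p + 1) * (p + B)); first by ring.
transitivity ((q + 1) * (B + p * C) + p * q * (2 * (B * C))); last by ring.
(* The identity [(p + 1) * (p + B) = B + p * (p + B + 1)] brings out the factor known from [pE]. *)
rewrite [in RHS]qE; transitivity (2 * B * B + p * (2 * (B * C)) * (q + 1)).
  by rewrite -pE qE; ring.
by ring.
Qed.

Theorem theorem9 (a b : nat) (hb : 1 <= b) (hab : b < a) :
  let q := 2 ^ (b + 1) - 1 in
  let p := 2 ^ (a + 1) - (2 ^ b + 1) in
  let n := p * q * 2 ^ a in
  strongly_pseudoperfect n /\
  (prime p -> prime q ->
   exists S : {fset nat},
     strongly_pseudoperfect_rep n S /\ #|` omitted_divisors n S|%fset = 4).
Proof.
move=> q p n.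
(* As [1 <= b], [2 ^ b] is even and at least 2, which makes [p] odd and [q] greater than 1. *)
have B_even : 2 ^ b = 2 * 2 ^ b.-1 by rewrite -expnS prednK.
have B_gt0 : 0 < 2 ^ b.-1 by rewrite expn_gt0.
(* As [b < a], [2 ^ (a - b)] is at least 2; hence the subtraction in [p] is not truncated, and
   [q < p]. *)
have BC_ge : 2 * 2 ^ b <= 2 ^ b * 2 ^ (a - b).
  by rewrite mulnC leq_mul2l (@leq_exp2l 2 1) // subn_gt0 hab orbT.
have aE : 2 ^ a = 2 ^ b * 2 ^ (a - b) by rewrite -expnD subnKC // ltnW.
have qE : q + 1 = 2 * 2 ^ b by rewrite /q expnD; lia.
have pE : p + 2 ^ b + 1 = 2 * (2 ^ b * 2 ^ (a - b)).
  by rewrite /p expnD aE; lia.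
have odd_q : odd q by lia.
have odd_p : odd p by lia.
have q_gt1 : 1 < q by lia.
have lt_qp : q < p by lia.
have n_gt0 : 0 < n by rewrite !muln_gt0 expn_gt0 andbT; lia.
pose cs := [:: 1; p; q; p * q].
have odd_cs : all odd cs by rewrite /= oddM odd_p odd_q.
have uniq_cs : uniq cs.
  have lt_p_pq : p < p * q by rewrite ltn_Pmulr //; lia.
  by rewrite /= !inE; lia.
pose s := pow2_multiples cs a.
pose t := [:: 2 ^ b; p * 2 ^ (a - b); q * 2 ^ b; p * q * 2 ^ (a - b)].
have le_ba : b <= a by exact: ltnW.
have sub_ts : {subset t <= s}.
  have s_mem c i : c \in cs -> i <= a -> c * 2 ^ i \in s.
    by move=> cs_c le_ia; apply/pow2_multiplesP; exists c, i.
  apply/allP; rewrite /= -{1}(mul1n (2 ^ b)).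
  by rewrite !s_mem ?leq_subr // !inE eqxx ?orbT.
have uniq_t : uniq t.
  (* The exponents [b] and [a - b] may coincide, so distinctness is read off the odd parts, which
     are the entries of [cs]. *)
  pose f ci := ci.1 * 2 ^ ci.2.
  have -> : t = map f [:: (1, b); (p, a - b); (q, b); (p * q, a - b)].
    by rewrite /= /f mul1n.
  rewrite map_inj_in_uniq; first by apply: (@map_uniq _ _ fst).
  have odd1 ci : ci \in [:: (1, b); (p, a - b); (q, b); (p * q, a - b)] ->
      odd ci.1.
    by rewrite !inE => /or4P[]/eqP-> //=; rewrite oddM odd_p.
  move=> [c i] [d j] /odd1/= odd_c /odd1/= odd_d.
  by case/(odd_mul_pow2_inj _ _ _ _ odd_c odd_d) => -> /= ->.
have cs_codiv c : c \in cs -> exists2 c', c' \in cs & c * c' = p * q.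
  rewrite !inE => /or4P[]/eqP->.
  - by exists (p * q); rewrite ?mul1n // !inE eqxx !orbT.
  - by exists q; rewrite // !inE eqxx !orbT.
  - by exists p; rewrite 1?mulnC // !inE eqxx !orbT.
  - by exists 1; rewrite ?muln1.
(* The codivisor of [c * 2 ^ i] is [c' * 2 ^ (a - i)] with [c * c' = p * q]; the product form
   postpones division to [divnE]. *)
have s_codiv d : d \in s -> exists2 e, e \in s & d * e = n.
  case/pow2_multiplesP=> c [i [/cs_codiv[c' cs_c' cc'] le_ia ->]].
  exists (c' * 2 ^ (a - i)).
    by apply/pow2_multiplesP; exists c', (a - i); rewrite leq_subr.
  by rewrite mulnACA cc' -expnD subnKC.
have divnE d e : d * e = n -> n %/ d = e.
  move=> den; rewrite -den mulKn //.
  by move: n_gt0; rewrite -den muln_gt0 => /andP[].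
have s_dvd : {in s, forall d, d %| n}.
  by move=> d /s_codiv[e _ <-]; apply: dvdn_mulr.
have s_closed : {in s, forall d, n %/ d \in s}.
  by move=> d /s_codiv[e s_e /divnE->].
have t_closed : {in t, forall d, n %/ d \in t}.
  move=> d; rewrite 4!in_cons in_nil orbF => /or4P[]/eqP->.
  - rewrite (divnE _ (p * q * 2 ^ (a - b))) ?inE ?eqxx ?orbT //.
    by rewrite /n aE; ring.
  - rewrite (divnE _ (q * 2 ^ b)) ?inE ?eqxx ?orbT //.
    by rewrite /n aE; ring.
  - rewrite (divnE _ (p * 2 ^ (a - b))) ?inE ?eqxx ?orbT //.
    by rewrite /n aE; ring.
  - rewrite (divnE _ (2 ^ b)) ?inE ?eqxx ?orbT //.
    by rewrite /n aE; ring.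
have sum_st : \sum_(d <- s) d = \sum_(d <- t) d + 2 * n.
  (* Reading [pE] backwards turns the factor [2 ^ a.+1 - 1] into [p + 2 ^ b]. *)
  rewrite sum_pow2_multiples !big_cons !big_nil expnS aE -pE addnK /n aE.
  exact: sum_excess pE qE.
have rep := strongly_pseudoperfect_rep_diff n n_gt0 s t
  (pow2_multiples_uniq cs a odd_cs uniq_cs) uniq_t sub_ts s_dvd s_closed t_closed
  sum_st.
split; first by split; last by eexists; exact: rep.
move=> p_pr q_pr; eexists; split; first exact: rep.
rewrite (omitted_divisors_diff n n_gt0) // => d.
by rewrite -dvdn_divisors //; apply: mem_pow2_multiples_prime.
Qed.
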